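(* If $G$ is a $(K_2^c+(K_1\cup K_2))$-minor-free graph, then $\chi'_{gl}(G)\leq \Delta(G)+1$. In particular, every $K_{2,3}$-minor-free graph $G$ is edge-$(\Delta(G)+1)$-group choosable.
   Context: All graphs are finite and simple; $\Delta(G)$ is the maximum degree of $G$. $K_2^c+(K_1\cup K_2)$ is the join of the edgeless graph on two vertices with the disjoint union of $K_1$ and $K_2$; equivalently, it is the graph obtained from $K_{2,3}$ by adding an edge joining two vertices of degree $2$. $\ell(G)$ denotes the line graph of $G$ (its vertices are the edges of $G$, two being adjacent iff they share an endpoint in $G$). Let $H$ be a graph with a fixed orientation of its edges, $A$ an Abelian group, $L:V(H)\to 2^A$ a list assignment and $f:E(H)\to A$. An $(A,L,f)$-coloring of $H$ is a map $c:V(H)\to A$ with $c(v)\in L(v)$ for every vertex $v$ and $c(x)-c(y)\neq f(xy)$ for every edge $xy$ directed from $x$ to $y$. $H$ is $(A,L)$-colorable if it has an $(A,L,f)$-coloring for every $f:E(H)\to A$ (this does not depend on the orientation). $H$ is $k$-group choosable if it is $(A,L)$-colorable for every Abelian group $A$ of order at least $k$ and every $L$ with $|L(v)|=k$ for all $v\in V(H)$. $\chi_{gl}(H)$ is the smallest $k$ such that $H$ is $k$-group choosable. $G$ is edge-$k$-group choosable if $\ell(G)$ is $k$-group choosable, and $\chi'_{gl}(G)=\chi_{gl}(\ell(G))$. *)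

(* Defs.v *)
From HB Require Import structures.
From mathcomp Require Import all_boot all_order all_algebra finmap.
From mathcomp Require Import boolp classical_sets functions cardinality.

Set Implicit Arguments.
Unset Strict Implicit.
Unset Printing Implicit Defensive.

Import GRing.Theory.
Local Open Scope ring_scope.

Record sgraph := SGraph {
  vertex :> finType;
  adj : rel vertex;
  adj_sym : symmetric adj;
  adj_irr : irreflexive adj
}.
Arguments adj {s}.

Definition max_degree (G : sgraph) : nat :=
  (\max_(x : G) #|[pred y : G | adj x y]|)%N.

Definition is_edge (G : sgraph) (e : {set G}) : bool :=
  [exists x, exists y, adj x y && (e == [set x; y]%SET)].

Definition edge (G : sgraph) : finType := {e : {set G} | is_edge e}.

Section GraphConstructions.

Definition complete_rel n : rel 'I_n := fun x y => x != y.
Lemma complete_sym n : symmetric (@complete_rel n).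
Proof. by move=> x y; rewrite /complete_rel eq_sym. Qed.
Lemma complete_irr n : irreflexive (@complete_rel n).
Proof. by move=> x; rewrite /complete_rel eqxx. Qed.
Definition complete_graph n : sgraph :=
  SGraph (@complete_sym n) (@complete_irr n).

Variables G H : sgraph.

Definition compl_rel : rel G := fun x y => (x != y) && ~~ adj x y.
Lemma compl_sym : symmetric compl_rel.
Proof. by move=> x y; rewrite /compl_rel eq_sym adj_sym. Qed.
Lemma compl_irr : irreflexive compl_rel.
Proof. by move=> x; rewrite /compl_rel eqxx. Qed.
Definition compl_graph : sgraph := SGraph compl_sym compl_irr.

Definition sum_rel (b : bool) : rel (G + H)%type := fun x y =>
  match x, y with
  | inl x', inl y' => adj x' y'
  | inr x', inr y' => adj x' y'
  | _, _ => b
  end.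
Lemma sum_rel_sym b : symmetric (sum_rel b).
Proof. by move=> [x|x] [y|y] //=; rewrite adj_sym. Qed.
Lemma sum_rel_irr b : irreflexive (sum_rel b).
Proof. by move=> [x|x] /=; rewrite adj_irr. Qed.
Definition union_graph : sgraph :=
  SGraph (sum_rel_sym false) (sum_rel_irr false).
Definition join_graph : sgraph :=
  SGraph (sum_rel_sym true) (sum_rel_irr true).

Definition line_rel : rel (edge G) := fun e1 e2 =>
  (e1 != e2) && [exists v, (v \in val e1) && (v \in val e2)].
Lemma line_sym : symmetric line_rel.
Proof.
move=> x y; rewrite /line_rel eq_sym; congr (_ && _).
by apply: eq_existsb => v; rewrite andbC.
Qed.
Lemma line_irr : irreflexive line_rel.
Proof. by move=> x; rewrite /line_rel eqxx. Qed.
Definition line_graph : sgraph := SGraph line_sym line_irr.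

End GraphConstructions.

Definition K2c_join_K1_K2 : sgraph :=
  join_graph (compl_graph (complete_graph 2))
             (union_graph (complete_graph 1) (complete_graph 2)).

Definition K23 : sgraph :=
  join_graph (compl_graph (complete_graph 2))
             (compl_graph (complete_graph 3)).

Definition connected_set (G : sgraph) (S : {set G}) : Prop :=
  S != finset.set0 /\
  {in S &, forall x y,
     connect [rel u v : G | [&& u \in S, v \in S & adj u v]] x y}.

(* The sets phi x are the branch sets of a model of H in G. *)
Definition minor (H G : sgraph) : Prop :=
  exists phi : H -> {set G},
    [/\ forall x, connected_set (phi x),
        forall x y, x != y -> [disjoint phi x & phi y]
      & forall x y, adj x y ->
          exists u v, [/\ u \in phi x, v \in phi y & adj u v]].

Definition minor_free (H G : sgraph) : Prop := ~ minor H G.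

Record orientation (G : sgraph) := Orientation {
  tail : edge G -> G;
  head : edge G -> G;
  orientationP : forall e, val e = [set tail e; head e]%SET
}.

Lemma tail_neq_head (G : sgraph) (D : orientation G) (e : edge G) :
  tail D e != head D e.
Proof.
apply/negP => /eqP th; have := valP e => /existsP[x /existsP[y /andP[xy /eqP]]].
rewrite (orientationP D e) th finset.setUid => E.
have: x \in [set head D e]%SET by rewrite E set21.
have: y \in [set head D e]%SET by rewrite E set22.
by rewrite !inE => /eqP yE /eqP xE; rewrite xE yE adj_irr in xy.
Qed.

Lemma orientation_exists (G : sgraph) : exists D : orientation G, True.
Proof.
have /choice[p pP] (e : edge G) :
    exists p : G * G, val e = [set p.1; p.2]%SET.
  by have /existsP[x /existsP[y /andP[_ /eqP E]]] := valP e; exists (x, y).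
by exists (@Orientation G (fst \o p) (snd \o p) pP).
Qed.

Definition group_coloring (H : sgraph) (D : orientation H) (A : zmodType)
    (L : H -> set A) (f : edge H -> A) (c : H -> A) : Prop :=
  (forall v, L v (c v)) /\
  (forall e, c (tail D e) - c (head D e) <> f e).

(* Ranging over all orientations is the same as fixing one: see
   group_colorable_fixed. *)
Definition group_colorable (H : sgraph) (A : zmodType) (L : H -> set A) : Prop :=
  forall (D : orientation H) (f : edge H -> A),
    exists c, group_coloring D L f c.

Lemma group_colorable_fixed (H : sgraph) (D : orientation H) (A : zmodType)
    (L : H -> set A) :
  group_colorable L <-> forall f : edge H -> A, exists c, group_coloring D L f c.
Proof.
split=> [HL f|HD D' f]; first exact: HL.
have [c [cL cf]] := HD (fun e => if tail D e == tail D' e then f e else - f e).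
exists c; split=> // e; have := cf e.
have E : [set tail D e; head D e]%SET = [set tail D' e; head D' e]%SET.
  by rewrite -!orientationP.
have th := tail_neq_head D e; have th' := tail_neq_head D' e.
have := set21 (tail D e) (head D e); have := set22 (tail D e) (head D e).
rewrite E !inE; have [tt|tt] /= := eqVneq (tail D e) (tail D' e).
  rewrite -tt eq_sym (negPf th) /= => /eqP hh _.
  by rewrite tt hh -tt.
move=> /orP[/eqP -> /eqP ->|/eqP hh /eqP tth].
  by move=> h h'; apply: h; rewrite -h' opprB.
by rewrite hh tth eqxx in th.
Qed.

(* A ranges over finite and infinite groups. *)
Definition group_choosable (k : nat) (H : sgraph) : Prop :=
  forall A : zmodType, (`I_k #<= [set: A])%card ->
  forall L : H -> set A, (forall v, (L v #= `I_k)%card) ->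
  group_colorable L.

Lemma card_pick_notin (A : choiceType) (k : nat) (L : set A) (s : seq A) :
  (L #= `I_k)%card -> (size s < k)%N -> exists2 x, L x & x \notin s.
Proof.
move=> Lk sk; apply: contrapT => nox.
have Ls : (L `<=` [set` [fset x in s]%fset])%classic.
  move=> x Lx /=; rewrite inE; apply: contrapT => /negP xs.
  by apply: nox; exists x.
have := subset_card_le Ls; rewrite (card_le_eql Lk).
have /card_eq_fsetP sE := erefl #|` [fset x in s]%fset|.
rewrite (card_le_eqr sE) card_le_II card_fseq => /leq_trans/(_ (size_undup s)).
by rewrite leqNgt sk.
Qed.

Lemma group_choosable_exists (H : sgraph) :
  exists k, `[< group_choosable k H >].
Proof.
exists #|edge H|.+1; apply/asboolP => A _ L Lk D f.
suff Hs (s : seq H) : uniq s -> exists c : H -> A,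
    (forall v, L v (c v)) /\
    (forall e, tail D e \in s -> head D e \in s ->
       c (tail D e) - c (head D e) <> f e).
  have [c [cL cf]] := Hs _ (enum_uniq H); exists c; split=> // e.
  by apply: cf; rewrite mem_enum.
elim: s => [_|v s IHs /= /andP[vs us]].
  have Lne v : exists x, L v x.
    by have [//|x Lx _] := @card_pick_notin A _ (L v) [::] (Lk v); exists x.
  by have [c cP] := choice Lne; exists c.
have [c [cL cf]] := IHs us.
pose bad := [seq if tail D e == v then c (head D e) + f e
                 else c (tail D e) - f e | e <- enum (edge H)].
have [|x Lx xbad] := @card_pick_notin A _ (L v) bad (Lk v).
  by rewrite size_map -cardE.
exists (fun u => if u == v then x else c u); split=> [u|e].
  by case: eqP => [->|].
have ebad : (if tail D e == v then c (head D e) + f e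
             else c (tail D e) - f e) \in bad.
  by apply: (map_f (fun e => if tail D e == v then c (head D e) + f e
                 else c (tail D e) - f e)); rewrite mem_enum.
have th := tail_neq_head D e; rewrite !inE; move: ebad.
have [tv|tv] := eqVneq (tail D e) v.
  rewrite -tv eq_sym (negPf th) => ebad _ _ xE; case/negP: xbad.
  by rewrite -[x](subrK (c (head D e))) xE addrC.
have [hv|hv] /= := eqVneq (head D e) v => [ebad _ _ xE|_].
  by case/negP: xbad; rewrite -[x](subKr (c (tail D e))) xE.
exact: cf.
Qed.

Definition chi_gl (H : sgraph) : nat := ex_minn (group_choosable_exists H).

Definition edge_group_choosable (k : nat) (G : sgraph) : Prop :=
  group_choosable k (line_graph G).

Definition chi'_gl (G : sgraph) : nat := chi_gl (line_graph G).

(* Main.v *)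
From mathcomp Require Import all_algebra finmap.
From mathcomp Require Import boolp classical_sets functions cardinality.
From mathcomp Require Import all_boot.
From mathcomp Require Import zify.
Require Import Defs.

Set Implicit Arguments.
Unset Strict Implicit.
Unset Printing Implicit Defensive.

Import GRing.Theory.

(** A K_4 with one edge subdivided, which is what K_2^c + (K_1 u K_2) is, is
    the only obstruction, and it enters through the degrees of the vertices.
    Write Delta for the maximum degree of G.  The edges of G get their colours
    from lists of size Delta + 1 by induction on the set F of edges to be
    coloured, the subgraphs with edge set F again having no such minor.

    An edge xy of F meets deg_F x + deg_F y - 2 other edges of F, so it can be
    coloured last as soon as deg_F x + deg_F y <= Delta + 2
    ([extend_light_edge]).  This is the case when one of its ends has degree at
    most 2.  Otherwise every vertex on an edge of F has degree at least 3 in F,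
    and a longest path yields a K_4 ([K4_of_min_degree]).  Indeed all the
    neighbours of an end x of a longest path lie on that path.  If x is
    adjacent to a vertex c of the path and b precedes c, then reversing the
    piece from x to b gives another longest path, ending at b.  Taking this
    piece as short as possible, over all longest paths, forces both x and b to
    have neighbours beyond c ([crossing_path]): otherwise one of them has its
    third neighbour strictly before c, and using it instead of c shortens the
    piece.  The path, the edge xc and the edges from x and b beyond c form a
    subdivided K_4.  Without the forbidden minor no edge of this K_4 is
    subdivided, whatever neighbours of x and b are chosen
    ([crossing_path_tight]); so the path starts with x, b, c, d, these vertices
    form a K_4, and x and b have degree exactly 3.

    If Delta >= 4, then xb is an edge with degree sum 6 <= Delta + 2.
    If Delta = 3, then the K_4 is a component, its line graph is the octahedron
    and the lists have size 4, one for each neighbour.  Two opposite vertices p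
    and p' of the octahedron can be coloured so that together they exclude only
    one colour from the list of a common neighbour q ([share_forbidden]), by a
    counting argument; the greedy algorithm, with q coloured last, does the
    rest ([colors_octahedron]). *)

(** * Longest paths and their rotations *)

Section LongestPath.

Variables (V : finType) (e : rel V).
Hypothesis e_sym : symmetric e.

Definition longest_path (s : seq V) :=
  [/\ uniq s, sorted e s &
      forall s', uniq s' -> sorted e s' -> size s' <= size s].

Lemma longest_path_exists (x y : V) :
  x != y -> e x y -> exists2 s, longest_path s & 1 < size s.
Proof.
move=> xy exy.
pose P n := [exists t : n.-tuple V, uniq t && sorted e t].
have PP s : uniq s -> sorted e s -> P (size s).
  by move=> us es; apply/existsP; exists (in_tuple s); rewrite us.
have P2 : P 2 by apply: (PP [:: x; y]); rewrite /= ?inE ?xy ?exy.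
have Pmax n : P n -> n <= #|V|.
  move=> /existsP[t /andP[ut _]].
  by rewrite -(size_tuple t) -(card_uniqP ut) max_card.
have [n /existsP[t /andP[ut et]] nmax] := ex_maxnP (ex_intro P 2 P2) Pmax.
exists t; last by rewrite size_tuple nmax.
by split=> // s us es; rewrite size_tuple; apply: nmax; apply: PP.
Qed.

(** A neighbour outside the path would prolong it. *)
Lemma longest_path_nbr (x z : V) (s : seq V) :
  longest_path (x :: s) -> e x z -> z \in x :: s.
Proof.
move=> [us es smax] exz; apply: contraLR (leqnn (size (x :: s))) => zs.
by rewrite -ltnNge (smax (z :: x :: s)) //= ?zs // e_sym exz.
Qed.

Lemma rotate_rev (x b : V) (t : seq V) :
  rev (x :: rcons t b) = b :: rcons (rev t) x.
Proof. by rewrite rev_cons rev_rcons. Qed.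

(** Reversing the part before [c] uses the edge from [x] to [c] instead of the
    one from [b] to [c]: every such [b] becomes the end of a longest path, so
    that its neighbours too are confined to the path. *)
Lemma longest_path_rotate (x b c : V) (t s : seq V) :
  longest_path (x :: rcons t b ++ c :: s) -> e x c ->
  longest_path (b :: rcons (rev t) x ++ c :: s).
Proof.
rewrite -!cat_cons -rotate_rev => -[us es smax] exc.
split.
- by rewrite (perm_uniq (s2 := (x :: rcons t b) ++ c :: s)) // perm_cat2r perm_rev.
- move: es; rewrite !sorted_cat_cons -rev_cons rev_sorted => /andP[].
  rewrite (eq_sorted (e' := e)); last by move=> u v; rewrite e_sym.
  by rewrite -cats1 => /cat_sorted2[/= -> _] ->; rewrite e_sym exc.
- by move=> s' us' es'; rewrite size_cat size_rev -size_cat; apply: smax.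
Qed.

Hypothesis e_irr : irreflexive e.
Hypothesis e_deg : forall x y, e x y -> 2 < #|[set z | e x z]|.

Lemma third_nbr (x y p q : V) : e x y -> exists z, [/\ e x z, z != p & z != q].
Proof.
move=> /e_deg deg; have /subsetPn[z] : ~~ ([set z | e x z] \subset [set p; q]).
  apply: contraTN deg => /subset_leq_card le; rewrite -leqNgt (leq_trans le) //.
  by rewrite cards2; case: (_ == _).
by rewrite !inE negb_or => exz /andP[zp zq]; exists z.
Qed.

(** Descent on the length of [t].  When one of the two ends [x] and [b], say
    [x], has no neighbour in [s], its third neighbour lies strictly between its
    successor and [c], and can replace [c]. *)
Lemma crossing_path (x b c : V) (t s : seq V) :
  longest_path (x :: rcons t b ++ c :: s) -> e x c ->
  exists x b c t s, [/\ longest_path (x :: rcons t b ++ c :: s), e x c,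
                        has (e x) s & has (e b) s].
Proof.
have [n] := ubnP (size t); elim: n x b c t s => // n IHn x b c t s /ltnSE tn Ps exc.
have shorten x' b' t' : longest_path (x' :: rcons t' b' ++ c :: s) -> e x' c ->
    size t' <= n -> ~~ has (e x') s ->
    exists x b c t s, [/\ longest_path (x :: rcons t b ++ c :: s), e x c,
                          has (e x) s & has (e b) s].
  move=> Ps' exc' t'n /hasPn nos.
  case E : (rcons t' b') (size_rcons t' b') => [//|y t0] /= [st0].
  have [z [exz zy zc]] := third_nbr y c exc'.
  have : z \in t0.
    have := longest_path_nbr Ps' exz; rewrite E inE mem_cat !inE (negPf zy) (negPf zc).
    have [zx|_] := eqVneq z x'; first by rewrite zx e_irr in exz.
    by move=> /= /orP[|/nos] //; rewrite exz.
  move=> zt0; case/splitPr: zt0 E st0 => p1 p2 E st0.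
  apply: (IHn x' (last y p1) z (belast y p1) (p2 ++ c :: s)) => //.
    rewrite size_belast (leq_trans _ t'n) // -st0 size_cat /= addnS ltnS.
    exact: leq_addr.
  by rewrite -lastI; move: Ps'; rewrite E /= -catA.
have [hx|] := boolP (has (e x) s); last exact: (shorten x b t).
have [hb|hb] := boolP (has (e b) s); first by exists x, b, c, t, s.
have Ps' := longest_path_rotate Ps exc.
have [_ es _] := Ps.
apply: (shorten b x (rev t)) => //; last by rewrite size_rev.
move: es; rewrite -cat_cons sorted_cat_cons -rcons_cons => /andP[].
by rewrite -cats1 /= cat_path /= last_rcons => /and3P[].
Qed.

End LongestPath.

(** * Models of the subdivided K_4 made of paths *)

Section Minor.

Variable (G : sgraph).

Lemma connected_path (s : seq G) :
  s != [::] -> sorted adj s -> connected_set [set z in s].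
Proof.
case: s => // x s _ /= xs; split.
  by apply/set0Pn; exists x; rewrite inE mem_head.
set R := (X in connect X).
have Rs : path R x s.
  apply: (sub_in_path (P := [in x :: s]) (e := adj)) xs; last exact/allP.
  by move=> u v us vs uv; rewrite /R /= !inE in us vs *; rewrite us vs.
have Rsym : connect_sym R.
  by apply: sym_connect_sym => u v; rewrite /R /= adj_sym andbCA.
move=> u v; rewrite !inE => us vs; apply: (connect_trans (y := x)).
  by rewrite Rsym; apply: (path_connect Rs).
exact: (path_connect Rs).
Qed.

Definition touch (X Y : seq G) := has (fun u => has (adj u) Y) X.

Lemma touchI u v X Y :
  adj u v -> u \in X -> v \in Y -> touch X Y.
Proof. by move=> uv uX vY; apply/hasP; exists u => //; apply/hasP; exists v. Qed.

Lemma touch_sym X Y : touch X Y = touch Y X.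
Proof.
by apply/hasP/hasP => -[u uX /hasP[v vY uv]]; exists v => //; apply/hasP;
   exists u; rewrite // adj_sym.
Qed.

Lemma uniq_flatten_disjoint (ss : seq (seq G)) : uniq (flatten ss) ->
  pairwise (fun X Y => [disjoint [set z in X] & [set z in Y]]) ss.
Proof.
elim: ss => //= X ss IH; rewrite cat_uniq => /and3P[_ /hasPn XS /IH ->].
rewrite andbT; apply/allP => Y Yss; apply/pred0P => z; rewrite !inE.
apply/negP => /andP[zX zY]; have /XS : z \in flatten ss.
  by apply/flattenP; exists Y.
by rewrite zX.
Qed.

(** The branch vertices of the K_4 are [u], [v], [b] and [c]; the edge between
    [u] and [v] is the subdivided one, by [a]. *)
Lemma subdivided_K4_minor (u v a b c : seq G) :
  all (sorted adj) [:: u; v; a; b; c] -> all (fun s => s != [::]) [:: u; v; a; b; c] ->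
  uniq (flatten [:: u; v; a; b; c]) ->
  touch u a -> touch v a -> touch u b -> touch v b -> touch u c -> touch v c ->
  touch b c -> minor K2c_join_K1_K2 G.
Proof.
move=> es ns us ua va ub vb uc vc bc.
pose phi (z : K2c_join_K1_K2) : seq G := match z with
  | inl i => if val i == 0 then u else v
  | inr (inl _) => a
  | inr (inr i) => if val i == 0 then b else c
  end.
exists (fun z => [set y in phi z]); split.
- move=> z; have := es; have := ns => /= /and5P[n1 n2 n3 n4 /andP[n5 _]].
  move=> /and5P[e1 e2 e3 e4 /andP[e5 _]].
  by case: z => [i|[i|i]] /=; do ?[case: (_ == _)]; apply: connected_path.
- move=> x y; have := uniq_flatten_disjoint us => /=; rewrite !andbT.
  move=> /and4P[/and4P[duv dua dub duc] /and3P[dva dvb dvc] /andP[dab dac] dbc].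
  by move: x y => [[[|[|//]] ?]|[[[|//] ?]|[[|[|//]] ?]]]
     [[[|[|//]] ?]|[[[|//] ?]|[[|[|//]] ?]]]; rewrite -?(inj_eq val_inj) //= => _;
     do [by []|by rewrite disjoint_sym].
- have touchP X Y : touch X Y ->
      exists x y, [/\ x \in [set z in X], y \in [set z in Y] & adj x y].
    by case/hasP=> x xX /hasP[y yY xy]; exists x, y; rewrite !inE.
  move=> x y; move: x y => [[[|[|//]] ?]|[[[|//] ?]|[[|[|//]] ?]]]
     [[[|[|//]] ?]|[[[|//] ?]|[[|[|//]] ?]]] //= _;
     by apply: touchP; rewrite //= 1?touch_sym.
Qed.

End Minor.

(** * A K_4 in a graph of minimum degree three *)

Fact perm_segments1 (T : eqType) (x b c d : T) (t p q : seq T) :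
  perm_eq (flatten [:: [:: x]; [:: b]; t; c :: p; d :: q])
          (x :: rcons t b ++ c :: p ++ d :: q).
Proof.
by apply/permP => f; rewrite /= ?cats0 -cats1; do 3!rewrite ?count_cat /=; lia.
Qed.

Fact perm_segments2 (T : eqType) (x b c d : T) (t p q : seq T) :
  perm_eq (flatten [:: [:: c]; d :: q; p; x :: t; [:: b]])
          (x :: rcons t b ++ c :: p ++ d :: q).
Proof.
by apply/permP => f; rewrite /= ?cats0 -cats1; do 3!rewrite ?count_cat /=; lia.
Qed.

Fact perm_segments3 (T : eqType) (x b c d : T) (t p q : seq T) :
  perm_eq (flatten [:: [:: d]; [:: b]; q; x :: t; c :: p])
          (x :: rcons t b ++ c :: p ++ d :: q).
Proof.
by apply/permP => f; rewrite /= ?cats0 -cats1; do 3!rewrite ?count_cat /=; lia.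
Qed.

Section Structure.

Variables (G : sgraph) (e : rel G).
Hypotheses (e_sym : symmetric e) (e_adj : subrel e adj).
Hypothesis G_free : minor_free K2c_join_K1_K2 G.

(** [x], [b], [c] and [d] are the branch vertices of a subdivided K_4, whose
    subdivided edges run through [t] (from [x] to [b]), through [p] (from [c] to
    [d]) and through [q] (from [d] to [d'], a neighbour of [b]).  Each of the
    three being nontrivial gives a model, in which the rest of the path is shared
    out among the branch sets. *)
Lemma crossing_path_tight (x b c d d' : G) (t p q : seq G) :
  uniq (x :: rcons t b ++ c :: p ++ d :: q) ->
  path adj x (rcons t b ++ c :: p ++ d :: q) ->
  adj x c -> adj x d -> d' \in d :: q -> adj b d' ->
  [/\ t = [::], p = [::] & d' = d].
Proof.
move=> us; rewrite cat_path rcons_path last_rcons /= cat_path /=.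
move=> /and3P[/andP[xt tb] bc /and3P[cp pd dq]] xc xd d'q bd'.
have path_behead (z : G) (s : seq G) : path adj z s -> sorted adj s by move/path_sorted.
have last_behead (z : G) (s : seq G) : s != [::] -> last z s \in s.
  by case: s => // z' s _; rewrite [last _ _]/= mem_last.
have head_behead (z : G) (s : seq G) :
    s != [::] -> path adj z s -> exists2 z', z' \in s & adj z z'.
  by case: s => // z' s _ /= /andP[zz' _]; exists z'; rewrite ?mem_head.
split; apply/eqP.
- apply/negPn/negP => t0; apply: G_free.
  have [z zt xz] := head_behead _ _ t0 xt.
  apply: (@subdivided_K4_minor _ [:: x] [:: b] t (c :: p) (d :: q)).
  + by rewrite /= (path_behead _ _ xt) cp dq.
  + by rewrite /= t0.
  + by rewrite (perm_uniq (perm_segments1 _ _ _ _ _ _ _)).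
  + by rewrite (touchI xz) ?mem_head.
  + by rewrite touch_sym (touchI tb) ?mem_head // last_behead.
  + by rewrite (touchI xc) ?mem_head.
  + by rewrite (touchI bc) ?mem_head.
  + by rewrite (touchI xd) ?mem_head.
  + by rewrite (touchI bd') ?mem_head.
  + exact: touchI pd (mem_last _ _) (mem_head _ _).
- apply/negPn/negP => p0; apply: G_free.
  have [z zp cz] := head_behead _ _ p0 cp.
  apply: (@subdivided_K4_minor _ [:: c] (d :: q) p (x :: t) [:: b]).
  + by rewrite /= (path_behead _ _ cp) xt dq.
  + by rewrite /= p0.
  + by rewrite (perm_uniq (perm_segments2 _ _ _ _ _ _ _)).
  + by rewrite (touchI cz) ?mem_head.
  + by rewrite touch_sym (touchI pd) ?mem_head // last_behead.
  + by rewrite touch_sym (touchI xc) ?mem_head.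
  + by rewrite touch_sym (touchI xd) ?mem_head.
  + by rewrite touch_sym (touchI bc) ?mem_head.
  + by rewrite touch_sym (touchI bd') ?mem_head.
  + exact: touchI tb (mem_last _ _) (mem_head _ _).
- apply/negPn/negP => d'd; apply: G_free.
  have {}d'q : d' \in q by move: d'q; rewrite inE (negPf d'd).
  have q0 : q != [::] by apply: contraTneq d'q => ->.
  have [z zq dz] := head_behead _ _ q0 dq.
  apply: (@subdivided_K4_minor _ [:: d] [:: b] q (x :: t) (c :: p)).
  + by rewrite /= (path_behead _ _ dq) xt cp.
  + by rewrite /= q0.
  + by rewrite (perm_uniq (perm_segments3 _ _ _ _ _ _ _)).
  + by rewrite (touchI dz) ?mem_head.
  + by rewrite (touchI bd') ?mem_head.
  + by rewrite touch_sym (touchI xd) ?mem_head.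
  + rewrite touch_sym; exact: touchI tb (mem_last _ _) (mem_head _ _).
  + rewrite touch_sym; exact: touchI pd (mem_last _ _) (mem_head _ _).
  + by rewrite (touchI bc) ?mem_head.
  + by rewrite (touchI xc) ?mem_head.
Qed.

(** [d] and [d'] being arbitrary neighbours, this says that [x] and [b] have the
    same unique neighbour in [s], its first vertex. *)
Lemma crossing_path_minor_free (x b c d d' : G) (t s : seq G) :
  longest_path e (x :: rcons t b ++ c :: s) ->
  e x c -> d \in s -> e x d -> d' \in s -> e b d' ->
  [/\ t = [::], d' = d & exists s', s = d :: s'].
Proof.
move=> Ps xc ds xd d's bd'.
have [us /(sub_sorted e_adj) es _] := Ps.
case/splitPr: ds Ps us es d's => p q Ps us es.
rewrite mem_cat orbC => /orP[d'q|d'p].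
  have [|||t0 p0 ->] := crossing_path_tight us es _ _ d'q; rewrite ?e_adj //.
  by rewrite t0 p0; split=> //; exists q.
(* If d' comes before d, then reversing the part before c exchanges x and b. *)
case/splitPr: d'p Ps us es => p1 p2; rewrite -catA /= => Ps us es.
have [us' /(sub_sorted e_adj) es' _] := longest_path_rotate e_sym Ps xc.
have dq : d \in d' :: p2 ++ d :: q by rewrite inE mem_cat mem_head !orbT.
have bc : adj b c.
  by move: es; rewrite /= cat_path last_rcons => /andP[_ /andP[]].
have [||_ _ dd'] := crossing_path_tight us' es' bc _ dq; rewrite ?e_adj //.
move: us'; rewrite dd' -cat_cons -[c :: p1 ++ _]cat_cons catA cat_uniq => /and3P[_ _].
by rewrite /= mem_cat mem_head orbT.
Qed.

(** [w0] and [w1] have degree three.  The other two may have neighbours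
    elsewhere: the K_4 may be a block attached to the rest of the graph. *)
Lemma K4_of_min_degree (x y : G) :
  (forall x y, e x y -> 2 < #|[set z | e x z]|) -> e x y ->
  exists w0 w1 w2 w3,
    [/\ uniq [:: w0; w1; w2; w3], pairwise e [:: w0; w1; w2; w3],
        [set z | e w0 z] \subset [set w1; w2; w3]
      & [set z | e w1 z] \subset [set w0; w2; w3]].
Proof.
move=> deg exy.
have e_irr : irreflexive e by move=> z; apply/negP => /e_adj; rewrite adj_irr.
have xy : x != y by apply: contraTneq exy => ->; rewrite e_irr.
have [[|x1 [|y1 s0]] // Ps0 _] := longest_path_exists xy exy.
have [_ /= /andP[xy1 _] _] := Ps0.
have [z [xz zy zx]] := third_nbr deg y1 x1 xy1.
have : z \in s0.
  by have := longest_path_nbr e_sym Ps0 xz; rewrite !inE (negPf zy) (negPf zx).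
move=> zs0; case/splitPr: zs0 Ps0 => p q Ps0.
have [|x2 [b [c [t [s [Ps xc xs bs]]]]]] :=
  @crossing_path _ e e_sym e_irr deg x1 (last y1 p) z (belast y1 p) q _ xz.
  by rewrite -lastI.
have [d ds xd] := hasP xs; have [d' d's bd'] := hasP bs.
have [t0 d'd [s' sE]] := crossing_path_minor_free Ps xc ds xd d's bd'.
rewrite {}t0 {}sE {}d'd {t ds d's} /= in Ps xs bs bd' *.
have Qs := longest_path_rotate (t := [::]) e_sym Ps xc; rewrite /= in Qs.
have [us /= /and4P[xb bc _ _] _] := Ps.
have only_d v : v \in s' -> ~~ e x2 v && ~~ e b v.
  move=> vs; have vs1 : v \in d :: s' by rewrite inE vs orbT.
  have vd : v != d.
    by apply: contraTneq vs => ->; have /and5P[] := us.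
  apply/andP; split; apply: contraNN vd => ev; apply/eqP.
  - by have [_ _ [s'' []]] :=
      crossing_path_minor_free (t := [::]) Ps xc vs1 ev (mem_head _ _) bd'.
  - by have [_ -> _] :=
      crossing_path_minor_free (t := [::]) Ps xc (mem_head _ _) xd vs1 ev.
exists x2, b, c, d; split.
- by move: us; rewrite -[_ :: _]/([:: x2; b; c; d] ++ s') cat_uniq => /andP[].
- have [_ /= /and4P[_ _ cd _] _] := Ps.
  by rewrite /= xb xc xd bc bd' cd.
- apply/subsetP => v; rewrite !inE => ev.
  have := longest_path_nbr e_sym Ps ev; rewrite !inE.
  case/or4P => [/eqP vx|->|->|/orP[->|/only_d]]; rewrite ?orbT //;
    last by rewrite ev.
  by rewrite vx e_irr in ev.
- apply/subsetP => v; rewrite !inE => ev.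
  have := longest_path_nbr e_sym Qs ev; rewrite !inE.
  case/or4P => [/eqP vx|->|->|/orP[->|/only_d]]; rewrite ?orbT //;
    last by rewrite ev andbF.
  by rewrite vx e_irr in ev.
Qed.

End Structure.

(** * Group colouring, one vertex at a time *)

Section Coloring.

Local Open Scope ring_scope.

Variables (H : sgraph) (A : zmodType) (k : nat) (L : H -> set A) (g : H -> H -> A).
Hypothesis L_card : forall v, (L v #= `I_k)%card.
Hypothesis gN : forall u v, adj u v -> g v u = - g u v.

(** [g u v] is the difference forbidden along an edge from [u] to [v].  Reading
    each edge in both directions makes the constraint symmetric, hence independent
    of an orientation. *)
Definition colors (F : {set H}) (c : H -> A) :=
  (forall v, L v (c v)) /\ {in F &, forall u v, adj u v -> c v <> c u + g u v}.

Lemma colors_setU1 (F : {set H}) (c : H -> A) (v : H) (x : A) :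
  colors F c -> v \notin F -> L v x ->
  {in F, forall u, adj u v -> x <> c u + g u v} ->
  exists2 c', colors (v |: F) c' & c' v = x /\ {in F, c' =1 c}.
Proof.
move=> [cL cF] vF Lx cx; exists [eta c with v |-> x]; last first.
  by split=> [|u uF] /=; rewrite ?eqxx //; case: eqP uF vF => // -> ->.
split=> [u|u w] /=; first by case: eqP => [->|_].
have nF z : z \in F -> z == v = false.
  by move=> zF; apply: contraNF vF => /eqP <-.
move=> /setU1P[->|uF] /setU1P[->|wF] uw; rewrite ?eqxx ?nF //.
- by rewrite adj_irr in uw.
- move=> E; apply: (cx w); rewrite // 1?adj_sym //.
  by rewrite E (gN uw) addrK.
- exact: cx.
- exact: cF.
Qed.

Lemma colors_greedy (F : {set H}) (c : H -> A) (v : H) (s : seq H) :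
  colors F c -> v \notin F -> (size s < k)%N ->
  {in F, forall u, adj u v -> u \in s} ->
  exists2 c', colors (v |: F) c' & {in F, c' =1 c}.
Proof.
move=> cF vF sk sP.
have [|x Lx xs] := @card_pick_notin A k (L v) [seq c u + g u v | u <- s] (L_card v).
  by rewrite size_map.
have [|c' c'F [_ c'c]] := colors_setU1 cF vF Lx; last by exists c'.
move=> u uF uv xE; case/negP: xs; rewrite xE.
exact/(map_f (fun u => c u + g u v))/sP.
Qed.

(** If [y] is not in [L w], only [z + t] is excluded.  If it is, choose [z] with
    [z + t] equal to [y] or outside [L w]: the values of [z] to be avoided
    correspond to the k - 1 elements of [L w] other than [y], while [L v] has k
    elements. *)
Lemma share_forbidden (v w : H) (y t : A) :
  (0 < k)%N -> exists2 z, L v z &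
    exists a, forall x, L w x -> x <> a -> x <> y /\ x <> z + t.
Proof.
move=> k0.
have [X LX] : exists X : {fset A}, L w = [set` X]%classic.
  by apply/finite_fsetP; exists k.
have Xk : #|` X| = k by apply/card_eq_fsetP; rewrite -LX.
have LwX x : L w x -> x \in X by rewrite LX.
have [yX|yX] := boolP (y \in X).
  have [|z Lz zX] := @card_pick_notin A k (L v) [seq b - t | b <- rem y X] (L_card v).
    by rewrite size_map size_rem // Xk prednK.
  exists z => //; exists y => x /LwX xX xy; split=> // xz; case/negP: zX.
  have -> : z = x - t by rewrite xz addrK.
  apply: (map_f (fun b => b - t)); rewrite mem_rem_uniq ?fset_uniq // inE.
  by apply/andP; split=> //; apply/eqP.
have [//|z Lz _] := @card_pick_notin A k (L v) [::] (L_card v).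
exists z => //; exists (z + t) => x /LwX xX xz; split=> // xy.
by case/negP: yX; rewrite -xy.
Qed.

(** [p], [p'] and [q], [q'] and [r], [r'] are the opposite pairs of an octahedron
    that is a component.  Every vertex but the last, [q], sees at most three
    colours when its turn comes, and [q] sees four neighbours but loses one colour
    only to [p] and [p']. *)
Lemma colors_octahedron (F : {set H}) (c : H -> A) (p p' q q' r r' : H) :
  (3 < k)%N -> colors F c -> uniq [:: p; p'; q; q'; r; r'] ->
  {in [:: p; p'; q; q'; r; r'], forall v, v \notin F /\ {in F, forall u, ~~ adj u v}} ->
  ~~ adj p p' -> ~~ adj q q' -> ~~ adj r r' ->
  exists c', colors (q |: (r' |: (r |: (q' |: (p' |: (p |: F)))))) c'.
Proof.
move=> k3 cF us sF pp qq rr.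
have k0 : (0 < k)%N by apply: leq_trans k3.
have nF v : v \in [:: p; p'; q; q'; r; r'] -> v \notin F by case/sF.
have noF u v : v \in [:: p; p'; q; q'; r; r'] -> u \in F -> adj u v -> False.
  by move=> /sF[_ h] /h /negP.
move: us; rewrite /= !inE !negb_or => /and5P[].
move=> /and5P[npp' npq npq' npr npr'] /and4P[np'q np'q' np'r np'r'].
move=> /and3P[nqq' nqr nqr'] /andP[nq'r nq'r'] /andP[nrr' _].
have [||c1 c1F _] := @colors_greedy F c p [::] cF _ k0.
- exact/nF/mem_head.
- by move=> u uF /(noF u p (mem_head _ _) uF).
have [z Lz [a aP]] := share_forbidden p' q (c1 p + g p q) (g p' q) k0.
have pF1 : p \in p |: F by rewrite setU11.
have [||c2 c2F [c2p' c21]] := colors_setU1 (v := p') c1F _ Lz.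
- by rewrite in_setU1 negb_or eq_sym npp' nF ?inE ?eqxx ?orbT.
- move=> u /setU1P[->|uF] up'; first by rewrite up' in pp.
  by case: (noF u p' _ uF up'); rewrite !inE eqxx ?orbT.
have [|||c3 c3F c32] := @colors_greedy _ c2 q' [:: p; p'] c2F.
- by rewrite !in_setU1 !negb_or ![q' == _]eq_sym np'q' npq' nF ?inE ?eqxx ?orbT.
- exact: leq_trans k3.
- move=> u; rewrite !inE => /or3P[->|->|uF]; rewrite ?orbT // => uq'.
  by case: (noF u q' _ uF uq'); rewrite !inE eqxx ?orbT.
have [|||c4 c4F c43] := @colors_greedy _ c3 r [:: p; p'; q'] c3F.
- by rewrite !in_setU1 !negb_or ![r == _]eq_sym npr np'r nq'r nF ?inE ?eqxx ?orbT.
- exact: leq_trans k3.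
- move=> u; rewrite !inE => /or4P[->|->|->|uF]; rewrite ?orbT // => ur.
  by case: (noF u r _ uF ur); rewrite !inE eqxx ?orbT.
have [|||c5 c5F c54] := @colors_greedy _ c4 r' [:: p; p'; q'] c4F.
- rewrite !in_setU1 !negb_or ![r' == _]eq_sym npr' np'r' nq'r' nrr' nF //.
  by rewrite !inE eqxx ?orbT.
- exact: leq_trans k3.
- move=> u /setU1P[-> rr'|]; first by rewrite rr' in rr.
  rewrite !inE => /or4P[->|->|->|uF]; rewrite ?orbT // => ur.
  by case: (noF u r' _ uF ur); rewrite !inE eqxx ?orbT.
have c5p : c5 p = c1 p by rewrite c54 ?c43 ?c32 ?c21 // !inE eqxx ?orbT.
have c5p' : c5 p' = z by rewrite c54 ?c43 ?c32 ?c2p' // !inE eqxx ?orbT.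
have [x Lx] := @card_pick_notin A k (L q)
  [:: a; c5 r + g r q; c5 r' + g r' q] (L_card q) k3.
rewrite !inE !negb_or => /and3P[/eqP xa /eqP xr /eqP xr'].
have [xp xp'] := aP x Lx xa.
have [||c6 c6F _] := colors_setU1 (v := q) c5F _ Lx; last by exists c6.
- rewrite !in_setU1 !negb_or nqr nqr' nqq' ![q == _]eq_sym npq np'q nF //.
  by rewrite !inE eqxx !orbT.
- move=> u /setU1P[-> //|/setU1P[-> //|/setU1P[->|/setU1P[-> _|/setU1P[-> _|uF]]]]].
  + by rewrite adj_sym (negPf qq).
  + by rewrite c5p'.
  + by rewrite c5p.
  + by move=> uq; case: (noF u q _ uF uq); rewrite !inE eqxx ?orbT.
Qed.

End Coloring.

(** * Forbidden differences from an orientation *)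

Lemma edge_of_adj (H : sgraph) (u v : H) : adj u v -> exists e : edge H, val e = [set u; v].
Proof.
move=> uv; have uvE : is_edge [set u; v].
  by apply/existsP; exists u; apply/existsP; exists v; rewrite uv eqxx.
by exists (exist (fun e : {set H} => is_edge e) _ uvE).
Qed.

Lemma set2_eq (T : finType) (a b c d : T) :
  a != b -> [set a; b] = [set c; d] -> (a = c /\ b = d) \/ (a = d /\ b = c).
Proof.
move=> ab E; have: a \in [set c; d] by rewrite -E set21.
have: b \in [set c; d] by rewrite -E set22.
rewrite !inE => /orP[/eqP bc|/eqP bd] /orP[/eqP ac|/eqP ad]; auto.
- by rewrite ac bc eqxx in ab.
- by rewrite ad bd eqxx in ab.
Qed.

Section Shift.

Local Open Scope ring_scope.

Variables (H : sgraph) (D : orientation H) (A : zmodType) (f : edge H -> A).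

Definition shift (u v : H) : A :=
  if [pick e : edge H | val e == [set u; v]] is Some e
  then if tail D e == u then - f e else f e else 0.

Lemma shift_tail_head (e : edge H) : shift (tail D e) (head D e) = - f e.
Proof.
rewrite /shift; case: pickP => [e' | /(_ e)]; last by rewrite -orientationP eqxx.
by rewrite -orientationP => /eqP/val_inj ->; rewrite eqxx.
Qed.

Lemma shift_head_tail (e : edge H) : shift (head D e) (tail D e) = f e.
Proof.
rewrite /shift finset.setUC; case: pickP => [e' | /(_ e)];
  last by rewrite -orientationP eqxx.
by rewrite -orientationP => /eqP/val_inj ->; rewrite (negPf (tail_neq_head D e)).
Qed.

Lemma shiftN (u v : H) : adj u v -> shift v u = - shift u v.
Proof.
move=> /edge_of_adj[e]; rewrite (orientationP D) => /(set2_eq (tail_neq_head D e)).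
by case=> -[<- <-]; rewrite shift_tail_head shift_head_tail ?opprK.
Qed.

Lemma colors_group_coloring (L : H -> set A) (c : H -> A) :
  colors L shift [set: H] c -> group_coloring D L f c.
Proof.
move=> [cL cF]; split=> // e E.
have th : adj (tail D e) (head D e).
  have /existsP[x /existsP[y /andP[xy /eqP]]] := valP e.
  rewrite (orientationP D) => /(set2_eq (tail_neq_head D e)).
  by case=> -[-> ->]; rewrite // adj_sym.
apply: (cF _ _ _ _ th); rewrite ?in_setT // shift_tail_head -E.
by rewrite opprB addrC subrK.
Qed.

End Shift.

(** * Colouring the edges of a graph *)

Section LineGraph.

Variable G : sgraph.
Implicit Types (F : {set edge G}) (x y z : G) (a b : edge G).

Definition link F : rel G := fun x y => [exists a in F, val a == [set x; y]].

Definition incident F x := [set a in F | x \in val a].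

Lemma link_sym F : symmetric (link F).
Proof. by move=> x y; rewrite /link finset.setUC. Qed.

Lemma linkP F x y :
  reflect (exists2 a, a \in F & val a = [set x; y]) (link F x y).
Proof.
by apply: (iffP existsP) => [[a /andP[aF /eqP]]|[a aF /eqP ae]];
   exists a => //; rewrite aF.
Qed.

Lemma adj_ends a x y : val a = [set x; y] -> adj x y.
Proof.
have /existsP[x' /existsP[y' /andP[xy' /eqP ->]]] := valP a.
have x'y' : x' != y' by apply: contraTneq xy' => ->; rewrite adj_irr.
by case/(set2_eq x'y') => -[<- <-]; rewrite // adj_sym.
Qed.

Lemma link_adj F : subrel (link F) adj.
Proof. by move=> x y /linkP[a _ /adj_ends]. Qed.

Lemma other_end a x : x \in val a -> exists y, val a = [set x; y].
Proof.
have /existsP[x' /existsP[y' /andP[_ /eqP ->]]] := valP a.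
by rewrite !inE => /orP[] /eqP ->; [exists y' | exists x'; rewrite finset.setUC].
Qed.

Lemma card_incident F x : #|incident F x| <= #|[set z | link F x z]|.
Proof.
rewrite -(card_imset (incident F x) val_inj).
apply: leq_trans (leq_imset_card (fun z => [set x; z]) _).
apply/subset_leq_card/subsetP => B /imsetP[a].
rewrite inE => /andP[aF /other_end[y ay]] ->.
by apply/imsetP; exists y => //; rewrite inE; apply/linkP; exists a.
Qed.

Lemma degree_link F x : #|[set z | link F x z]| <= max_degree G.
Proof.
apply: leq_trans (leq_bigmax (F := fun x : G => #|[pred y : G | adj x y]|) x).
by apply/subset_leq_card/subsetP => z; rewrite !inE => /link_adj.
Qed.

Lemma line_adjP a b : reflect (a <> b /\ exists2 v, v \in val a & v \in val b)
  (@adj (line_graph G) a b).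
Proof.
apply: (iffP andP) => -[ab vab]; split.
- exact/eqP.
- by have /existsP[v /andP[va vb]] := vab; exists v.
- exact/eqP.
- by have [v va vb] := vab; apply/existsP; exists v; rewrite va.
Qed.

Section Extension.

Local Open Scope ring_scope.

Variables (A : zmodType) (k : nat) (L : line_graph G -> set A).
Variable (g : line_graph G -> line_graph G -> A).
Hypothesis L_card : forall v, (L v #= `I_k)%card.
Hypothesis gN : forall u v, adj u v -> g v u = - g u v.

(** The edge [a] itself is counted at both of its ends, so that at most k - 1
    edges of [F] meet it. *)
Lemma extend_light_edge F a x y c :
  a \in F -> val a = [set x; y] -> (#|incident F x| + #|incident F y| <= k.+1)%N ->
  colors L g (F :\ a) c -> exists c', colors L g F c'.
Proof.
move=> aF axy le cF.
have ax : a \in incident F x by rewrite inE aF axy set21.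
have ay : a \in incident F y by rewrite inE aF axy set22.
pose s := enum ((incident F x :\ a) :|: (incident F y :\ a)).
have sk : (size s < k)%N.
  rewrite -cardE; apply: leq_ltn_trans (leq_card_setU _ _) _.
  by move: le; rewrite (cardsD1 a) ax [X in (_ + X)%N](cardsD1 a) ay addnACA.
have [||c' c'F _] := colors_greedy L_card gN (v := a) cF _ sk.
- by rewrite setD11.
- move=> u /setD1P[ua uF] /line_adjP[_ [v vu]]; rewrite axy mem_enum !inE ua uF.
  by move=> /orP[]/eqP <-; rewrite vu ?orbT.
by exists c'; rewrite -(setD1K aF).
Qed.

(** The degree bound makes the K_4 a component of the graph with edge set [F]; the
    pairs of disjoint edges are the opposite pairs of the octahedron. *)
Lemma extend_K4_component F (w0 w1 w2 w3 : G) :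
  (3 < k)%N -> uniq [:: w0; w1; w2; w3] -> pairwise (link F) [:: w0; w1; w2; w3] ->
  (forall x, #|incident F x| <= 3)%N ->
  (forall F', F' \proper F -> exists c, colors L g F' c) ->
  exists c, colors L g F c.
Proof.
move=> k3 uw; rewrite /= !andbT => /and3P[/and3P[]].
move=> /linkP[a01 a01F v01] /linkP[a02 a02F v02] /linkP[a03 a03F v03].
move=> /andP[/linkP[a12 a12F v12] /linkP[a13 a13F v13]] /linkP[a23 a23F v23] deg IH.
pose six := [:: a01; a23; a02; a13; a03; a12].
move: uw; rewrite /= !inE !negb_or !andbT => /and3P[/and3P[n01 n02 n03] /andP[n12 n13] n23].
have usix : uniq six.
  (* The four vertices determine which of the six edges this is. *)
  pose code a := [seq w \in val a | w <- [:: w0; w1; w2; w3]].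
  apply: (@map_uniq _ _ code); rewrite /= /code /= v01 v23 v02 v13 v03 v12 !inE !eqxx.
  rewrite ![w1 == w0]eq_sym ![w2 == w0]eq_sym ![w3 == w0]eq_sym ![w2 == w1]eq_sym.
  rewrite ![w3 == w1]eq_sym ![w3 == w2]eq_sym.
  rewrite (negPf n01) (negPf n02) (negPf n03).
  by rewrite (negPf n12) (negPf n13) (negPf n23).
have sixF : {subset six <= F}.
  by apply/allP; rewrite /= a01F a23F a02F a13F a03F a12F.
(* Three of the six edges at a vertex of degree at most 3 are all its edges. *)
have incident3 w (m : bitseq) : size (mask m six) = 3 ->
    all (fun a => w \in val a) (mask m six) -> {subset incident F w <= six}.
  move=> s3 /allP sw a; rewrite -mem_enum.
  have [||_ <-] := uniq_min_size (mask_uniq usix m) (s2 := enum (incident F w)).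
  - by move=> b bs; rewrite mem_enum inE (sixF b (mem_mask bs)) sw.
  - by rewrite -cardE s3.
  - exact: mem_mask.
have wsix a w : a \in F -> w \in val a -> w \in [:: w0; w1; w2; w3] -> a \in six.
  move=> aF wa w4; have aw : a \in incident F w by rewrite inE aF.
  rewrite !inE in w4; case/or4P: w4 aw => /eqP-> aw.
  - apply: (incident3 w0 [:: true; false; true; false; true; false]) aw => //.
    by rewrite /= v01 v02 v03 !set21.
  - apply: (incident3 w1 [:: true; false; false; true; false; true]) aw => //.
    by rewrite /= v01 v13 v12 set22 !set21.
  - apply: (incident3 w2 [:: false; true; true; false; false; true]) aw => //.
    by rewrite /= v23 v02 v12 set21 !set22.
  - apply: (incident3 w3 [:: false; true; false; true; true; false]) aw => //.
    by rewrite /= v23 v13 v03 !set22.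
have six_ends a v : a \in six -> v \in val a -> v \in [:: w0; w1; w2; w3].
  rewrite !inE => /or4P[/eqP->|/eqP->|/eqP->|/or3P[]/eqP->];
    by rewrite ?(v01, v02, v03, v12, v13, v23) !inE => /orP[]->; rewrite ?orbT.
have [|c cF] := IH (F :\: [set a in six]).
  apply/properP; split; first exact: subsetDl.
  by exists a01; rewrite // !inE eqxx.
have disj a b : (forall v, v \in val a -> v \in val b -> False) ->
    ~~ adj (a : line_graph G) b.
  by move=> ab; apply/negP => /line_adjP[_ [v va vb]]; apply: (ab v).
have [] := colors_octahedron L_card gN k3 cF usix.
- move=> a a6; split; first by rewrite inE inE a6.
  move=> b; rewrite inE inE => /andP[b6 bF]; apply: disj => v vb va.
  by case/negP: b6; apply: (wsix b v bF vb (six_ends a v a6 va)).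
- apply: disj => v; rewrite v01 v23 !inE => /orP[]/eqP->.
    by rewrite (negPf n02) (negPf n03).
  by rewrite (negPf n12) (negPf n13).
- apply: disj => v; rewrite v02 v13 !inE => /orP[]/eqP->.
    by rewrite (negPf n01) (negPf n03).
  by rewrite eq_sym (negPf n12) (negPf n23).
- apply: disj => v; rewrite v03 v12 !inE => /orP[]/eqP->.
    by rewrite (negPf n01) (negPf n02).
  by rewrite eq_sym (negPf n13) eq_sym (negPf n23).
move=> c' c'F; exists c'; suff -> : F = a02 |: (a12 |: (a03 |: (a13 |: (a23 |: (a01 |:
  F :\: [set a in six]))))) by [].
apply/setP => u; rewrite !inE.
by do !case: eqP => [->|_] //=.
Qed.

End Extension.

Lemma edges_colorable (A : zmodType) (L : line_graph G -> set A)
    (g : line_graph G -> line_graph G -> A) F :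
  minor_free K2c_join_K1_K2 G ->
  (forall v, (L v #= `I_((max_degree G).+1))%card) ->
  (forall u v, adj u v -> g v u = - g u v)%R ->
  exists c, colors L g F c.
Proof.
move=> Gfree L_card gN; have [n] := ubnP #|F|; elim: n F => // n IHn F /ltnSE Fn.
have IH F' : F' \proper F -> exists c, colors L g F' c.
  by move=> /proper_card F'F; apply: IHn; apply: leq_trans F'F Fn.
have extend a x y : a \in F -> val a = [set x; y] ->
    #|incident F x| + #|incident F y| <= (max_degree G).+2 -> exists c, colors L g F c.
  move=> aF axy le; have [c cF] := IH _ (properD1 aF).
  exact: extend_light_edge L_card gN _ _ _ _ _ aF axy le cF.
have [/existsP[x /existsP[y /andP[/linkP[a aF axy] deg]]]|noxy] :=
  boolP [exists x, exists y, link F x y && (#|[set z | link F x z]| <= 2)].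
  apply: (extend a x y) => //; rewrite -add2n.
  apply: leq_add; first exact: leq_trans (card_incident F x) deg.
  exact: leq_trans (card_incident F y) (degree_link F y).
have deg x y : link F x y -> 2 < #|[set z | link F x z]|.
  move=> xy; rewrite ltnNge; apply: contraNN noxy => le.
  by apply/existsP; exists x; apply/existsP; exists y; rewrite xy.
have [F0|[a aF]] := set_0Vmem F.
  have Lne v : exists t, L v t.
    by have [//|t Lt _] := @card_pick_notin A _ (L v) [::] (L_card v); exists t.
  have [c cP] := choice Lne.
  by exists c; split=> // u v; rewrite F0 inE.
have /existsP[x /existsP[y /andP[_ /eqP axy]]] := valP a.
have xy : link F x y by apply/linkP; exists a.
have [w0 [w1 [w2 [w3 [uw ww deg0 deg1]]]]] :=
  K4_of_min_degree (@link_sym F) (@link_adj F) Gfree deg xy.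
(* The ends w0 and w1 have degree 3 and 3 + 3 <= max_degree G + 2; otherwise
   max_degree G = 3. *)
have [D4|D3] := leqP 4 (max_degree G).
  have /linkP[b bF bw] : link F w0 w1 by case/and4P: ww => /and3P[].
  have le3 w (S : {set G}) :
      [set z | link F w z] \subset S -> #|S| <= 3 -> #|incident F w| <= 3.
    move=> /subset_leq_card h1 h2.
    exact: leq_trans (card_incident F w) (leq_trans h1 h2).
  apply: (extend b w0 w1) => //; apply: (@leq_trans (3 + 3)); last by rewrite !ltnS.
  have c3 (u v w : G) : #|[set u; v; w]| <= 3.
    by rewrite finset.setUC cardsU1 cards2; case: (_ \in _); case: (_ == _).
  by apply: leq_add; [apply: le3 deg0 _ | apply: le3 deg1 _]; apply: c3.
apply: (extend_K4_component L_card gN _ uw ww _ IH); last first.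
  by move=> z; apply: leq_trans (leq_trans (card_incident F z) (degree_link F z)) _.
exact: leq_trans (deg _ _ xy) (degree_link F x).
Qed.

End LineGraph.

Theorem theorem4p6 (G : sgraph) :
  (minor_free K2c_join_K1_K2 G -> chi'_gl G <= (max_degree G).+1) /\
  (minor_free K23 G -> edge_group_choosable (max_degree G).+1 G).
Proof.
have choosable : minor_free K2c_join_K1_K2 G ->
    edge_group_choosable (max_degree G).+1 G.
  move=> Gfree A _ L L_card D f.
  have [c cF] := edges_colorable [set: edge G] Gfree L_card (shiftN D f).
  by exists c; apply: colors_group_coloring.
split=> [/choosable ch|Gfree].
  by rewrite /chi'_gl /chi_gl; case: ex_minnP => m _; apply; apply/asboolP.
apply: choosable => -[phi [phi_conn phi_disj phi_adj]]; apply: Gfree.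
(* K_{2,3} is a spanning subgraph: h maps its three vertices of degree 2 to the
   vertices of K_1 and K_2. *)
pose h (z : K23) : K2c_join_K1_K2 := match z with
  | inl i => inl i
  | inr i => inr (if val i is j.+1 then inr (inord j) else inl ord0)
  end.
pose h' (z : K2c_join_K1_K2) : K23 := match z with
  | inl i => inl i
  | inr (inl _) => inr ord0
  | inr (inr j) => inr (inord j.+1)
  end.
have h_inj : injective h.
  apply: (can_inj (g := h')) => -[i|[[|j] j3]] //=; congr inr; apply: val_inj => //=.
  by rewrite !inordK.
have h_adj x y : adj x y -> adj (h x) (h y).
  by case: x y => [i|i] [j|j] //= /andP[/= ij]; rewrite /complete_rel ij.
exists (phi \o h); split=> [x|x y xy|x y /h_adj/phi_adj //].
  exact: phi_conn.
by apply: phi_disj; rewrite (inj_eq h_inj).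
Qed.
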